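(* Let $n\geq 1$ be an integer. Then the Munarini graph $M_{n,1}$ is isomorphic to the Fibonacci cube $\Gamma_{n-1}$, and the Munarini graph $M_{n,2}$ is isomorphic to the Pell graph $\Pi_n$.
   Context: For integers $k\geq 1$, $n\geq 0$, a $k$-generalized Pell string of length $n$ is a word of length $n$ over the alphabet $\{0,1,\ldots,k\}$ in which every maximal run of the character $k$ has even length (equivalently, a concatenation of letters from $\{0,1,\ldots,k-1,kk\}$). Let $\mathcal{F}_{n,k}$ be the set of these strings (for $n=0$ it contains only the empty string). The Munarini graph $M_{n,k}$ is the simple graph with vertex set $\mathcal{F}_{n,k}$ in which two vertices are adjacent if one of them can be obtained from the other either by replacing one occurrence of $0$ with some $i\in\{1,\ldots,k-1\}$, or by replacing one substring $00$ (two consecutive positions) with $kk$ (both replacements may be read in either direction, and both strings must be in $\mathcal{F}_{n,k}$). The Fibonacci cube $\Gamma_n$ is the subgraph of the hypercube $Q_n$ (vertex set $\{0,1\}^n$, two strings adjacent iff they differ in exactly one coordinate) induced by the binary strings of length $n$ with no two consecutive $1$s; $\Gamma_0=K_1$. The Pell graph $\Pi_n$ has as vertices the words of length $n$ over $\{0,1,2\}$ in which every maximal run of $2$s has even length (Pell strings); two vertices are adjacent if one is obtained from the other by replacing one $0$ with $1$ (or vice versa), or by replacing one substring $11$ with $22$ (or vice versa), in such a way that the new string is again a Pell string. *)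

(* Defs.v *)
From mathcomp Require Import all_boot.

Set Implicit Arguments.
Unset Strict Implicit.
Unset Printing Implicit Defensive.

Record simple_graph := SimpleGraph {
  vertex :> finType;
  adj : rel vertex;
  adj_sym : symmetric adj;
  adj_irrefl : irreflexive adj
}.

Definition graph_isomorphic (G H : simple_graph) : Prop :=
  exists f : G -> H,
    bijective f /\ forall x y : G, adj (f x) (f y) = adj x y.

Section Induced.
Variables (G : simple_graph) (P : pred G).

Definition induced_adj : rel {x : G | P x} :=
  fun x y => adj (val x) (val y).

Lemma induced_adj_sym : symmetric induced_adj.
Proof. by move=> x y; apply: adj_sym. Qed.

Lemma induced_adj_irrefl : irreflexive induced_adj.
Proof. by move=> x; apply: adj_irrefl. Qed.

Definition induced : simple_graph :=
  SimpleGraph induced_adj_sym induced_adj_irrefl.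
End Induced.

Section Words.
Variable T : eqType.
Implicit Types (c : T) (w p q s t u v : seq T).

(* The occurrences of c at positions i, ..., i + m - 1 of w form a maximal
   run; [onth] is [None] past the end of w. *)
Definition maximal_run c w (i m : nat) : bool :=
  [&& 0 < m, i + m <= size w, take m (drop i w) == nseq m c,
      (i == 0) || (onth w i.-1 != Some c) & onth w (i + m) != Some c].

Definition even_runs c w : bool :=
  [forall i : 'I_(size w), forall m : 'I_(size w).+1,
     maximal_run c w i m ==> ~~ odd m].

(* t is obtained from s by replacing one occurrence of p with q, the
   occurrence starting at position i; see replacesP. *)
Definition replaces p q s t : bool :=
  [exists i : 'I_(size s).+1,
     (s == take i s ++ p ++ drop (i + size p) s)
     && (t == take i s ++ q ++ drop (i + size p) s)].

Lemma replacesP p q s t :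
  reflect (exists u v, s = u ++ p ++ v /\ t = u ++ q ++ v) (replaces p q s t).
Proof.
apply: (iffP existsP) => [[i /andP[/eqP es /eqP et]]|[u [v [-> ->]]]].
  by exists (take i s), (drop (i + size p) s).
have lt_i : size u < (size (u ++ p ++ v)).+1 by rewrite size_cat ltnS leq_addr.
exists (Ordinal lt_i) => /=.
have -> : drop (size u + size p) (u ++ p ++ v) = v.
  by rewrite catA drop_size_cat ?size_cat.
by rewrite take_size_cat // !eqxx.
Qed.

Lemma replaces_irrefl p q s : size p = size q -> p != q -> ~~ replaces p q s s.
Proof.
move=> epq npq; apply/negP => /replacesP[u [v [es]]]; rewrite es => /eqP.
by rewrite eqseq_cat // eqxx /= eqseq_cat // (negbTE npq).
Qed.
End Words.

(* The set of k-generalized Pell strings of length n: words over {0, ..., k},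
   where ord_max is the letter k. *)
Definition gen_pell_string (n k : nat) : finType :=
  {w : n.-tuple 'I_k.+1 | even_runs ord_max w}.

Section Munarini.
Variables (n k : nat).
Local Notation zero := (@ord0 k).
Local Notation top := (@ord_max k).
Implicit Types x y : gen_pell_string n k.

Definition munarini_step x y : bool :=
  [exists i : 'I_k.+1,
     (0 < i < k) && replaces [:: zero] [:: i] (val x) (val y)]
  || replaces [:: zero; zero] [:: top; top] (val x) (val y).

Definition munarini_adj : rel (gen_pell_string n k) :=
  fun x y => munarini_step x y || munarini_step y x.

Lemma munarini_adj_sym : symmetric munarini_adj.
Proof. by move=> x y; apply: orbC. Qed.

Hypothesis k_gt0 : 0 < k.

Lemma munarini_adj_irrefl : irreflexive munarini_adj.
Proof.
move=> x; rewrite /munarini_adj orbb /munarini_step; apply/norP; split.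
  rewrite negb_exists; apply/forallP => i; rewrite negb_and -implybE.
  apply/implyP => /andP[i_gt0 _]; apply: replaces_irrefl => //.
  by rewrite eqseq_cons andbT -val_eqE /= eq_sym -lt0n.
apply: replaces_irrefl => //.
by rewrite !eqseq_cons -!val_eqE /= eq_sym -leqn0 leqNgt k_gt0.
Qed.

Definition munarini : simple_graph :=
  SimpleGraph munarini_adj_sym munarini_adj_irrefl.
End Munarini.

Section Hypercube.
Variable n : nat.

Definition hypercube_adj : rel (n.-tuple bool) :=
  fun x y => #|[set i | tnth x i != tnth y i]| == 1.

Lemma hypercube_adj_sym : symmetric hypercube_adj.
Proof.
move=> x y; congr (_ == _); apply: eq_card => i.
by rewrite !inE eq_sym.
Qed.

Lemma hypercube_adj_irrefl : irreflexive hypercube_adj.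
Proof.
move=> x; rewrite /hypercube_adj.
by rewrite eq_card0 // => i; rewrite !inE eqxx.
Qed.

Definition hypercube : simple_graph :=
  SimpleGraph hypercube_adj_sym hypercube_adj_irrefl.
End Hypercube.

Definition fibonacci_string (n : nat) : pred (hypercube n) :=
  fun x => ~~ infix [:: true; true] (x : n.-tuple bool).

Definition fibonacci_cube (n : nat) : simple_graph :=
  induced (@fibonacci_string n).

Section Pell.
Variable n : nat.
Local Notation zero := (@ord0 2).
Local Notation one := (@Ordinal 3 1 isT).
Local Notation two := (@ord_max 2).

Definition pell_string : finType :=
  {w : n.-tuple 'I_3 | even_runs two w}.

Implicit Types x y : pell_string.

Definition pell_step x y : bool :=
  replaces [:: zero] [:: one] (val x) (val y)
  || replaces [:: one; one] [:: two; two] (val x) (val y).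

Definition pell_adj : rel pell_string :=
  fun x y => pell_step x y || pell_step y x.

Lemma pell_adj_sym : symmetric pell_adj.
Proof. by move=> x y; apply: orbC. Qed.

Lemma pell_adj_irrefl : irreflexive pell_adj.
Proof.
move=> x; rewrite /pell_adj orbb /pell_step; apply/norP.
by split; apply: replaces_irrefl.
Qed.

Definition pell_graph : simple_graph :=
  SimpleGraph pell_adj_sym pell_adj_irrefl.
End Pell.

(* Main.v *)
Require Import Defs.
From mathcomp Require Import all_boot.
From mathcomp Require Import zify.

Set Implicit Arguments.
Unset Strict Implicit.
Unset Printing Implicit Defensive.

(** For [k = 1], a word is encoded by the starting positions of its blocks
    [11], that is, by the parities [b_j] of the number of [1]s among its first
    [j] letters, [0 < j < n]. All runs of [1]s are even exactly when no two
    consecutive parities are odd and the total parity is even, and replacing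
    [00] by [11] flips exactly one [b_j]. Conversely, if [b] and [b'] differ
    only at [j] and [b'_j = 1], the neighbours of [j] vanish in [b'], hence in
    [b], so the words read [00] and [11] there.

    For [k = 2], exchanging the letters [0] and [1] is an isomorphism: it turns
    [00 <-> 22] into [11 <-> 22] and reverses [0 -> 1]. *)

(** * Runs and prefix parities *)

Section Parity.
Variable T : eqType.
Implicit Types (c : T) (w : seq T).

(** False past the end of [w], so positions need no bound. *)
Definition occurs_at c w j : bool := onth w j == Some c.

Definition prefix_parity c w j : bool := odd (count_mem c (take j w)).

Lemma prefix_parity0 c w : prefix_parity c w 0 = false.
Proof. by rewrite /prefix_parity take0. Qed.

Lemma prefix_parityS c w j :
  prefix_parity c w j.+1 = prefix_parity c w j (+) occurs_at c w j.
Proof.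
rewrite /prefix_parity /occurs_at; elim: w j => [|a w IHw] [|j] //=.
  by rewrite take0 addn0 oddb.
by rewrite !oddD IHw addbA.
Qed.

Lemma maximal_runP c w i m :
  reflect [/\ 0 < m, forall j, i <= j < i + m -> occurs_at c w j,
              i = 0 \/ ~~ occurs_at c w i.-1 & ~~ occurs_at c w (i + m)]
          (maximal_run c w i m).
Proof.
apply: (iffP and5P) => -[m_gt0].
  move=> le_im /eqP e_run /orP left_end right_end; split=> //; last first.
    by case: left_end => [/eqP|]; [left | right].
  move=> j /andP[le_ij lt_j]; rewrite /occurs_at.
  have /(congr1 (fun s => onth s (j - i))) := e_run.
  rewrite onth_nseq ifT ?onthE; last by lia.
  rewrite map_take map_drop nth_take; last by lia.
  by rewrite nth_drop subnKC // -onthE => ->.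
move=> runs left_end right_end.
(* The last position of the run carries [c], hence lies inside the word. *)
have le_im : i + m <= size w.
  have /runs : i <= (i + m).-1 < i + m by lia.
  case: (ltnP (i + m).-1 (size w)) => [|/onth_default]; first by lia.
  by rewrite /occurs_at => ->.
split=> //; last by case: left_end => [->|->]; rewrite ?orbT.
apply/eqP/(@eq_from_nth _ c); rewrite size_takel ?size_nseq ?size_drop //;
  try lia.
move=> j lt_jm; rewrite nth_take // nth_drop nth_nseq lt_jm.
by apply: onth_nth; apply/eqP/runs; lia.
Qed.

Lemma even_runsP c w :
  reflect (forall i m, maximal_run c w i m -> ~~ odd m) (even_runs c w).
Proof.
apply: (iffP forallP) => [ev i m run|ev i]; last first.
  by apply/forallP => m; apply/implyP/ev.
have /and5P[m_gt0 le_im _ _ _] := run.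
have lt_i : i < size w by lia.
have lt_m : m < (size w).+1 by lia.
by have /forallP/(_ (Ordinal lt_m))/implyP := ev (Ordinal lt_i); apply.
Qed.

(* Between runs the parity is even, so it agrees with the parity of the length
   of the part already read of the current run. *)
Lemma even_runs_parity c w :
  even_runs c w <->
  forall j, ~~ (prefix_parity c w j && prefix_parity c w j.+1).
Proof.
split=> [/even_runsP ev j|par].
  (* Invariant: the run being read at [j] starts at [i] and has length [m] so far, with [m = 0]
     between runs. If letter [j] is not [c], a nonempty run is maximal, so [m] is even. *)
  suff [i [m [e_j runs left_end e_par]]] : exists i m, [/\ i + m = j,
      forall h, i <= h < i + m -> occurs_at c w h,
      i = 0 \/ ~~ occurs_at c w i.-1 & prefix_parity c w j = odd m].
    rewrite prefix_parityS e_par; case: (boolP (occurs_at c w j)) => [_|nj].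
      by rewrite addbT andbN.
    rewrite addbF andbb; case: (posnP m) => [-> //|m_gt0].
    by apply: (ev i); apply/maximal_runP; split=> //; rewrite e_j.
  elim: j => [|j [i [m [e_j runs left_end e_par]]]].
    by exists 0, 0; split; [|case|left|exact: prefix_parity0].
  rewrite prefix_parityS e_par.
  case: (boolP (occurs_at c w j)) => [yj|nj]; last first.
    exists j.+1, 0; split; [exact: addn0 | by move=> h; lia | by right |].
    rewrite addbF; apply/negbTE; case: (posnP m) => [-> //|m_gt0].
    by apply: (ev i); apply/maximal_runP; split=> //; rewrite e_j.
  exists i, m.+1; split=> //; [lia | | by rewrite addbT].
  move=> h; case: (ltngtP h j) => [||-> //]; last lia.
  by move=> lt_hj lt_h; apply: runs; lia.
(* A letter other than [c] keeps the parity, and two consecutive parities cannot both be odd. Thus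
   the parity is even on both sides of a maximal run. *)
have gap j : ~~ occurs_at c w j -> prefix_parity c w j = false.
  move=> /negbTE nj; apply/negbTE; have := par j.
  by rewrite prefix_parityS nj addbF andbb.
apply/even_runsP => i m /maximal_runP[_ runs left_end right_end].
have par_i : prefix_parity c w i = false.
  case: i left_end {runs right_end} => [|i]; first by rewrite prefix_parity0.
  by case=> //= ni; rewrite prefix_parityS (negbTE ni) gap.
suff -> : odd m = prefix_parity c w (i + m) by rewrite gap.
elim: m runs {right_end} => [|m IHm] runs; first by rewrite addn0 par_i.
rewrite addnS prefix_parityS -IHm => [|j lt_j]; last by apply: runs; lia.
by rewrite runs ?addbT //; lia.
Qed.

(** Past the end the parity is constant, so it cannot be odd twice in a row. *)
Lemma prefix_parity_oversize c w j :
  even_runs c w -> size w <= j -> prefix_parity c w j = false.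
Proof.
move=> /even_runs_parity /(_ j) par le_j; move: par; rewrite prefix_parityS.
by rewrite /occurs_at onth_default // addbF andbb => /negbTE.
Qed.

End Parity.

(** * Transport along injective maps of letters *)

Lemma even_runs_map (T U : eqType) (h : T -> U) (c : T) (w : seq T) :
  injective h -> even_runs (h c) (map h w) = even_runs c w.
Proof.
move=> h_inj.
have e_par : prefix_parity (h c) (map h w) =1 prefix_parity c w.
  move=> j; rewrite /prefix_parity -map_take count_map.
  by congr odd; apply: eq_count => a /=; rewrite inj_eq.
apply/idP/idP => /even_runs_parity par; apply/even_runs_parity => j.
  by rewrite -!e_par.
by rewrite !e_par.
Qed.

Lemma replaces_map (T U : eqType) (h : T -> U) (p q s t : seq T) :
  injective h ->
  replaces (map h p) (map h q) (map h s) (map h t) = replaces p q s t.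
Proof.
move=> h_inj; apply/idP/idP => [/existsP[[i /= _]]|/replacesP[u [v [-> ->]]]].
  (* The context is cut out by [take] and [drop], so it is itself an image under [h]. *)
  rewrite -!map_take size_map -!map_drop -!map_cat !(inj_eq (inj_map h_inj)).
  move=> /andP[/eqP es /eqP et].
  by apply/replacesP; exists (take i s), (drop (i + size p) s).
by apply/replacesP; exists (map h u), (map h v); rewrite !map_cat.
Qed.

(** * Pointwise forms of the Fibonacci condition and of hypercube adjacency *)

Lemma infix_ttP (s : seq bool) :
  reflect (exists i, nth false s i && nth false s i.+1)
          (infix [:: true; true] s).
Proof.
apply: (iffP (@infixP _ [:: true; true] s)) => [[u [v ->]]|[i /andP[si si1]]].
  exists (size u); rewrite !nth_cat ltnn subnn subSnn.
  by have -> : (size u).+1 < size u = false by lia.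
have lt_i1 : i.+1 < size s.
  by case: ltnP si1 => // le_s; rewrite nth_default.
exists (take i s), (drop i.+2 s).
rewrite -{1}(cat_take_drop i s) (drop_nth false) ?si; last by lia.
by rewrite (drop_nth false) // si1.
Qed.

Lemma hypercube_adjP n (x y : n.-tuple bool) :
  reflect (exists i : 'I_n, forall j : 'I_n, (tnth x j != tnth y j) = (j == i))
          (hypercube_adj x y).
Proof.
apply: (iffP cards1P) => -[i e_i]; exists i.
  by move=> j; have /setP/(_ j) := e_i; rewrite !inE.
by apply/setP => j; rewrite !inE.
Qed.

(** * The case of one nonzero letter: Fibonacci cubes *)

Section Fibonacci.
Local Notation zero := (@ord0 1).
Local Notation top := (@ord_max 1).

Lemma ord2_neq_top (a : 'I_2) : a != top -> a = zero.
Proof. by move=> na; apply/val_inj; case: a na => [[|[|]]]. Qed.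

Lemma occurs_at_nth (w : seq 'I_2) j :
  j < size w -> occurs_at top w j = (nth zero w j == top).
Proof. by move=> lt_j; rewrite /occurs_at onthE (nth_map zero). Qed.

Lemma eq_nth_occurs_at (s t : seq 'I_2) j : size s = size t -> j < size s ->
  occurs_at top s j = occurs_at top t j -> nth zero s j = nth zero t j.
Proof.
move=> e_st lt_j; rewrite !occurs_at_nth -?e_st //.
case: eqP => [-> /esym/eqP -> //|/eqP/ord2_neq_top -> /esym/negbT].
by move=> /ord2_neq_top.
Qed.

(** Two successive parities tell whether the letter between them is [top], which determines a letter
    of ['I_2]. *)
Lemma prefix_parity_inj (s t : seq 'I_2) : size s = size t ->
  prefix_parity top s =1 prefix_parity top t -> s = t.
Proof.
move=> e_st e_par; apply: (eq_from_nth (x0 := zero)) => // j lt_j.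
apply: eq_nth_occurs_at => //; have := e_par j.+1.
by rewrite !prefix_parityS e_par => /addbI.
Qed.

Lemma replaces_zeros_parity (s t : seq 'I_2) :
  replaces [:: zero; zero] [:: top; top] s t ->
  exists2 i, i.+1 < size s & forall j,
    (prefix_parity top s j != prefix_parity top t j) = (j == i.+1).
Proof.
move=> /replacesP[u [v [-> ->]]]; exists (size u).
  by rewrite !size_cat /=; lia.
move=> j; rewrite /prefix_parity !take_cat.
case: ltnP => [lt_j|le_j]; first by rewrite eqxx; lia.
rewrite !count_cat !oddD; have [k ->] : exists k, j = size u + k.
  by exists (j - size u); rewrite subnKC.
rewrite addKn -[(size u).+1]addn1 eqn_add2l.
(* The prefix ends before, in the middle of, or after the replaced pair; only in the middle do the
   counts of [top] differ by an odd number. *)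
case: k => [|[|k]] /=; [by rewrite eqxx | by case: (odd _) |].
by rewrite !oddD /= negbK eqxx.
Qed.

Lemma parity_replaces_zeros (s t : seq 'I_2) i :
  size s = size t -> i.+1 < size s -> even_runs top t ->
  (forall j, (prefix_parity top s j != prefix_parity top t j) = (j == i.+1)) ->
  prefix_parity top t i.+1 ->
  replaces [:: zero; zero] [:: top; top] s t.
Proof.
move=> e_st lt_i /even_runs_parity ev diff ti1.
have same j : j != i.+1 -> prefix_parity top s j = prefix_parity top t j.
  by rewrite -diff negbK => /eqP.
have si1 : prefix_parity top s i.+1 = false.
  by have := diff i.+1; rewrite ti1 eqxx; case: prefix_parity.
have ti : prefix_parity top t i = false.
  by have := ev i; rewrite ti1 andbT => /negbTE.
have ti2 : prefix_parity top t i.+2 = false.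
  by have := ev i.+1; rewrite ti1 => /negbTE.
have si : prefix_parity top s i = false by rewrite same //; lia.
have si2 : prefix_parity top s i.+2 = false by rewrite same //; lia.
have split_word (w : seq 'I_2) : i.+1 < size w ->
    w = take i w ++ [:: nth zero w i; nth zero w i.+1] ++ drop i.+2 w.
  by move=> lt_w; rewrite /= -!drop_nth ?cat_take_drop //; lia.
(* Letter [j] depends only on the parities at [j] and [j.+1], neither of which is the flipped
   one. *)
have nth_same j : j < size s -> j != i -> j != i.+1 ->
    nth zero s j = nth zero t j.
  move=> lt_j ni ni1; apply: eq_nth_occurs_at => //.
  have := same j.+1 ni; rewrite !prefix_parityS same //; exact: addbI.
apply/replacesP; exists (take i s), (drop i.+2 s); split.
  rewrite {1}(split_word s) //; congr (_ ++ [:: _; _] ++ _);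
    apply: ord2_neq_top; rewrite -occurs_at_nth //; try lia.
    by move: si1; rewrite prefix_parityS si /= => ->.
  by move: si2; rewrite prefix_parityS si1 /= => ->.
rewrite {1}(split_word t) -?e_st //; congr (_ ++ [:: _; _] ++ _).
- apply: (eq_from_nth (x0 := zero)) => [|j].
    by rewrite !size_take e_st.
  rewrite size_takel => [lt_j|]; last by lia.
  by rewrite !nth_take // nth_same //; lia.
- apply/eqP; rewrite -occurs_at_nth -?e_st //; last by lia.
  by move: ti1; rewrite prefix_parityS ti.
- apply/eqP; rewrite -occurs_at_nth -?e_st //.
  by move: ti2; rewrite prefix_parityS ti1 /= => /negbFE.
- apply: (eq_from_nth (x0 := zero)) => [|j].
    by rewrite !size_drop e_st.
  rewrite size_drop => lt_j.
  by rewrite !nth_drop nth_same //; lia.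
Qed.

Lemma munarini1_adjP n (x y : gen_pell_string n 1) :
  reflect (exists2 i, i.+1 < n & forall j,
             (prefix_parity top (val x) j != prefix_parity top (val y) j)
             = (j == i.+1))
          (munarini_adj x y).
Proof.
(* No letter lies strictly between [0] and [1], so only the move on pairs remains. *)
have stepE u v : munarini_step u v =
    replaces [:: zero; zero] [:: top; top] (val u) (val v).
  rewrite /munarini_step; case: existsP => // -[i] /andP[]; lia.
rewrite /munarini_adj !stepE; apply: (iffP orP) => [[|]|[i lt_i diff]].
- by move=> /replaces_zeros_parity[i]; rewrite size_tuple => ? ?; exists i.
- move=> /replaces_zeros_parity[i]; rewrite size_tuple => lt_i diff.
  by exists i => // j; rewrite eq_sym.
have := diff i.+1; rewrite eqxx.
(* The word with odd parity at [i.+1] is the one containing the block of two [top]. *)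
case: (boolP (prefix_parity top (val y) i.+1)) => [yi _|_ xi].
  left; apply: (@parity_replaces_zeros _ _ i) => //; rewrite ?size_tuple //.
  exact: (valP y).
right; apply: (@parity_replaces_zeros _ _ i) => //; rewrite ?size_tuple //.
- exact: (valP x).
- by move=> j; rewrite eq_sym.
- by move: xi; case: prefix_parity.
Qed.

Variable m : nat.

Definition block_starts (w : m.+1.-tuple 'I_2) : m.-tuple bool :=
  [tuple prefix_parity top w i.+1 | i < m].

(** No bound on [j]: from [m] on, the default [false] matches the even total parity. *)
Lemma nth_block_starts (x : gen_pell_string m.+1 1) j :
  nth false (block_starts (val x)) j = prefix_parity top (val x) j.+1.
Proof.
case: (ltnP j m) => [lt_j|le_j].
  by rewrite -[j]/(val (Ordinal lt_j)) -tnth_nth tnth_mktuple.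
rewrite nth_default ?size_tuple // prefix_parity_oversize ?size_tuple //.
exact: (valP x).
Qed.

Lemma block_starts_fibonacci (x : gen_pell_string m.+1 1) :
  @fibonacci_string m (block_starts (val x)).
Proof.
apply/infix_ttP => -[j]; rewrite !nth_block_starts.
by apply/negP; have /even_runs_parity := valP x.
Qed.

Definition pell_to_fibonacci (x : @munarini m.+1 1 isT) : fibonacci_cube m :=
  exist _ (block_starts (val x)) (block_starts_fibonacci x).

(** Differences of successive parities: the prepended [false] is the parity of the empty prefix, and
    the default [false] at [i = m] is the total parity. *)
Definition blocks_at (b : m.-tuple bool) : m.+1.-tuple 'I_2 :=
  [tuple if nth false (false :: b) i (+) nth false b i then top else zero
    | i < m.+1].

Lemma prefix_parity_blocks_at (b : m.-tuple bool) j :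
  prefix_parity top (blocks_at b) j = nth false (false :: b) j.
Proof.
elim: j => [|j IHj]; first exact: prefix_parity0.
rewrite prefix_parityS IHj; case: (ltnP j m.+1) => [lt_j|le_j]; last first.
  rewrite /occurs_at onth_default ?size_tuple // !nth_default //=;
    rewrite size_tuple //; lia.
rewrite occurs_at_nth ?size_tuple //.
rewrite -[j in nth zero _ j]/(val (Ordinal lt_j)) -tnth_nth tnth_mktuple /=.
by case: (nth _ (_ :: _) _); case: (nth _ _ _).
Qed.

Lemma blocks_at_even_runs (y : fibonacci_cube m) :
  even_runs top (blocks_at (val y)).
Proof.
apply/even_runs_parity => j; rewrite !prefix_parity_blocks_at.
case: j => [|j] //=; apply/negP => yj.
by have /infix_ttP := valP y; apply; exists j.
Qed.

Definition fibonacci_to_pell (y : fibonacci_cube m) : @munarini m.+1 1 isT :=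
  exist _ (blocks_at (val y)) (blocks_at_even_runs y).

Lemma pell_to_fibonacciK : cancel pell_to_fibonacci fibonacci_to_pell.
Proof.
move=> x; apply/val_inj/val_inj; apply: prefix_parity_inj => [|j].
  by rewrite !size_tuple.
rewrite prefix_parity_blocks_at; case: j => [|j].
  by rewrite prefix_parity0.
exact: nth_block_starts.
Qed.

Lemma fibonacci_to_pellK : cancel fibonacci_to_pell pell_to_fibonacci.
Proof.
move=> y; apply/val_inj/val_inj.
apply: (eq_from_nth (x0 := false)) => [|j _]; first by rewrite !size_tuple.
by rewrite (nth_block_starts (fibonacci_to_pell y)) prefix_parity_blocks_at.
Qed.

Lemma pell_to_fibonacci_adj (x y : @munarini m.+1 1 isT) :
  adj (pell_to_fibonacci x) (pell_to_fibonacci y) = adj x y.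
Proof.
apply/hypercube_adjP/munarini1_adjP => -[i].
  move=> diff; exists i; first by rewrite ltnS.
  (* The tuples record only parities at [1] to [m]; those at [0] and beyond [m] are even in both
     words. *)
  case=> [|j]; first by rewrite !prefix_parity0.
  case: (ltnP j m) => [lt_j|le_j].
    by have := diff (Ordinal lt_j); rewrite /= !tnth_mktuple.
  rewrite !prefix_parity_oversize ?size_tuple //; [|exact: valP y|exact: valP x].
  by rewrite eqxx eqSS; have := ltn_ord i; lia.
rewrite ltnS => lt_i diff; exists (Ordinal lt_i) => j.
by rewrite /= !tnth_mktuple diff eqSS.
Qed.

End Fibonacci.

Lemma munarini1_fibonacci_cube m :
  graph_isomorphic (@munarini m.+1 1 isT) (fibonacci_cube m).
Proof.
exists (@pell_to_fibonacci m); split; last exact: pell_to_fibonacci_adj.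
by exists (@fibonacci_to_pell m);
  [exact: pell_to_fibonacciK | exact: fibonacci_to_pellK].
Qed.

(** * The case of two nonzero letters: Pell graphs *)

Section Pell.
Variable n : nat.
Local Notation zero := (@ord0 2).
Local Notation one := (@Ordinal 3 1 isT).
Local Notation two := (@ord_max 2).

Definition swap01 (a : 'I_3) : 'I_3 :=
  if a == zero then one else if a == one then zero else a.

Lemma swap01K : involutive swap01.
Proof. by case=> [[|[|[|]]] // lt_a]; apply/val_inj. Qed.

Let swap01_inj : injective swap01 := inv_inj swap01K.

(** [swap01] is injective and fixes [two]. *)
Lemma swap_word_even_runs (x : gen_pell_string n 2) :
  even_runs two (map_tuple swap01 (val x)).
Proof. by have := valP x; rewrite -(even_runs_map two _ swap01_inj). Qed.

Definition swap_word (x : gen_pell_string n 2) : gen_pell_string n 2 :=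
  exist _ (map_tuple swap01 (val x)) (swap_word_even_runs x).

Lemma swap_wordK : involutive swap_word.
Proof. by move=> x; apply/val_inj/val_inj; rewrite /= (mapK swap01K). Qed.

Lemma munarini2_stepE (x y : gen_pell_string n 2) :
  munarini_step x y =
  replaces [:: zero] [:: one] (val x) (val y)
  || replaces [:: zero; zero] [:: two; two] (val x) (val y).
Proof.
congr (_ || _); apply/existsP/idP => [[i /andP[lt_i]]|rep]; last by exists one.
by have -> : i = one by apply/val_inj => /=; lia.
Qed.

Lemma swap_word_adj (x y : gen_pell_string n 2) :
  pell_adj (swap_word x) (swap_word y) = munarini_adj x y.
Proof.
(* The swap reverses this move, hence the exchange of [u] and [v]; the symmetrized adjacency absorbs
   it. *)
have rep01 u v : replaces [:: zero] [:: one]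
      (val (swap_word u)) (val (swap_word v))
    = replaces [:: zero] [:: one] (val v) (val u).
  rewrite -[[:: zero]]/(map swap01 [:: one]) -[[:: one]]/(map swap01 [:: zero]).
  rewrite replaces_map //=.
  by apply/replacesP/replacesP => -[p [q [-> ->]]]; exists p, q.
have rep2 u v : replaces [:: one; one] [:: two; two]
      (val (swap_word u)) (val (swap_word v))
    = replaces [:: zero; zero] [:: two; two] (val u) (val v).
  exact: (@replaces_map _ _ swap01 [:: zero; zero] [:: two; two]).
rewrite /pell_adj /munarini_adj !munarini2_stepE /pell_step !rep01 !rep2.
by rewrite orbACA [X in X || _]orbC orbACA.
Qed.

Lemma munarini2_pell_graph :
  graph_isomorphic (@munarini n 2 isT) (pell_graph n).
Proof.
exists swap_word; split; last exact: swap_word_adj.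
by exists swap_word; exact: swap_wordK.
Qed.

End Pell.

Theorem proposition2p4 (n : nat) (n_gt0 : 0 < n) :
  graph_isomorphic (@munarini n 1 isT) (fibonacci_cube n.-1) /\
  graph_isomorphic (@munarini n 2 isT) (pell_graph n).
Proof.
split; last exact: munarini2_pell_graph.
by case: n n_gt0 => // m _; exact: munarini1_fibonacci_cube.
Qed.
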